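(* There is an absolute constant $\alpha>0$ such that for all integers $N\ge 1$ and all even integers $n\ge 2^{N/2}$, every 1--3 tree on $n$ vertices contains leaf-to-leaf paths of at least $\alpha N^{2/3}$ distinct lengths, all lying between $0$ and $N$.
   Context: A 1--3 tree is a tree in which every vertex has degree $1$ or $3$. A leaf is a vertex of degree $1$; a leaf-to-leaf path is a path whose endpoints are both leaves, its length is its number of edges, and a single vertex is considered a path of length $0$. *)

(* Defs.v *)
From mathcomp Require Import all_boot all_order all_algebra.
From mathcomp Require Import reals exp.

Set Implicit Arguments.
Unset Strict Implicit.
Unset Printing Implicit Defensive.

Section Graphs.
Variables (T : finType) (e : rel T).

Definition simple_graph : Prop := symmetric e /\ irreflexive e.

Definition degree (x : T) : nat := #|[set y | e x y]|.

Definition connected_graph : Prop :=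
  (0 < #|T|)%N /\ forall x y : T, connect e x y.

(* Sequences of size at most 2 are excluded since [:: x; y] with e x y is a
   [ucycle] of the symmetric relation e but not a cycle of the graph. *)
Definition acyclic_graph : Prop :=
  forall c : seq T, (2 < size c)%N -> ~ ucycle e c.

Definition is_tree : Prop :=
  [/\ simple_graph, connected_graph & acyclic_graph].

Definition tree13 : Prop :=
  is_tree /\ forall x : T, degree x = 1%N \/ degree x = 3%N.

Definition leaf (x : T) : bool := degree x == 1%N.

(* The path visits x and then the vertices of p, so p has one entry per edge. *)
Definition leaf_path (x : T) (p : seq T) : bool :=
  [&& path e x p, uniq (x :: p), leaf x & leaf (last x p)].

Definition leaf_path_length (l : nat) : bool :=
  [exists x : T, exists p : l.-tuple T, leaf_path x p].

Definition leaf_path_lengths (N : nat) : {set 'I_N.+1} :=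
  [set l : 'I_N.+1 | leaf_path_length l].

End Graphs.

(* Main.v *)
(** Root the tree at a leaf, let K be the number of leaf-to-leaf lengths in
    [0, N], and let W - 1 be the largest distance from a vertex to its nearest
    leaf below (we may assume 2(W - 1) <= N). All even numbers up to 2(W - 1)
    are lengths, so K >= W. As n >= 2^(N/2), there is a descending path of
    about N/2 edges; if the nearest leaf hanging off its i-th vertex is at
    distance h_i, then 1 <= h_i <= W and (h_j + j) + (h_i - i) is a length for
    i < j. In a window of W consecutive indices h + i or h - i takes at least
    sqrt W values, and combining these with indices spaced by 3W along the path
    gives on the order of (N/W) sqrt W lengths. Hence K^2 W >= c N^2, and with
    W <= K this is K^3 >= c N^2. *)

Require Import Defs.
From mathcomp Require Import all_boot all_order all_algebra.
From mathcomp Require Import reals exp.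
From mathcomp Require Import zify.

Set Implicit Arguments.
Unset Strict Implicit.
Unset Printing Implicit Defensive.
Import Order.TTheory GRing.Theory Num.Theory.

(** * Leaf distances and path lengths in full binary trees *)

Inductive btree := Lf | Nd of btree & btree.

Fixpoint depths (t : btree) : seq nat :=
  if t is Nd a b then [seq d.+1 | d <- depths a ++ depths b] else [:: 0].

(** Each path is listed at its topmost vertex, whose two edges give the [2]; length 0 is left
    out. *)
Fixpoint path_lengths (t : btree) : seq nat :=
  if t is Nd a b then
    [seq d1 + d2 + 2 | d1 <- depths a, d2 <- depths b]
      ++ path_lengths a ++ path_lengths b
  else [::].

Fixpoint height (t : btree) : nat :=
  if t is Nd a b then (maxn (height a) (height b)).+1 else 0.

Fixpoint min_depth (t : btree) : nat :=
  if t is Nd a b then (minn (min_depth a) (min_depth b)).+1 else 0.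

Fixpoint max_min_depth (t : btree) : nat :=
  if t is Nd a b then
    maxn (min_depth t) (maxn (max_min_depth a) (max_min_depth b))
  else 0.

(* Along a longest descending path from the root, entry i is the distance from
   the i-th vertex to the nearest leaf of the branch leaving the path there. *)
Fixpoint spine (t : btree) : seq nat :=
  if t is Nd a b then
    if height b <= height a then (min_depth b).+1 :: spine a
    else (min_depth a).+1 :: spine b
  else [::].

Lemma min_depth_in t : min_depth t \in depths t.
Proof.
elim: t => [//|a IHa b IHb] /=.
rewrite (mem_map succn_inj) mem_cat.
by case: leqP => _; rewrite ?IHa ?IHb ?orbT.
Qed.

Lemma min_depth_le_max t : min_depth t <= max_min_depth t.
Proof. by case: t => //= a b; rewrite leq_maxl. Qed.

(* At a lowest vertex whose nearest leaf below is at distance k, both children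
   are at distance exactly k - 1 from their nearest leaf. *)
Lemma even_path_length t k :
  0 < k <= max_min_depth t -> k.*2 \in path_lengths t.
Proof.
elim: t => [|a IHa b IHb]; first by rewrite /=; lia.
move=> kt; rewrite [path_lengths _]/= !mem_cat.
have [ka|ka] := leqP k (max_min_depth a).
  by rewrite IHa ?orbT //; lia.
have [kb|kb] := leqP k (max_min_depth b).
  by rewrite IHb ?orbT //; lia.
have := min_depth_le_max a; have := min_depth_le_max b.
move: kt => /= kt mb ma.
apply/orP; left; apply/allpairsP; exists (min_depth a, min_depth b).
by split; rewrite ?min_depth_in //=; lia.
Qed.

Lemma size_spine t : size (spine t) = height t.
Proof.
elim: t => //= a IHa b IHb.
by case: leqP => h /=; rewrite ?IHa ?IHb; lia.
Qed.

Lemma spine_bound t x : x \in spine t -> 0 < x <= (max_min_depth t).+1.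
Proof.
elim: t => //= a IHa b IHb.
have := min_depth_le_max a; have := min_depth_le_max b => mb ma.
case: (leqP (height b)) => h /=; rewrite inE => /orP[/eqP-> | xs]; try lia.
- by have := IHa xs; lia.
- by have := IHb xs; lia.
Qed.

Lemma spine_depth t j : j < height t -> j + nth 0 (spine t) j \in depths t.
Proof.
elim: t j => //= a IHa b IHb j hj.
case: leqP => h; case: j hj => [|j] hj /=.
- by rewrite (mem_map succn_inj) mem_cat min_depth_in orbT.
- by rewrite addSn (mem_map succn_inj) mem_cat IHa //; lia.
- by rewrite (mem_map succn_inj) mem_cat min_depth_in.
- by rewrite addSn (mem_map succn_inj) mem_cat IHb ?orbT //; lia.
Qed.

(** The path runs along the spine between vertices [i] and [j] and leaves it at both ends towards a
    nearest leaf. Induction reduces to [i = 0], where the root is its topmost vertex. *)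
Lemma spine_path_length t i j : i < j < height t ->
  nth 0 (spine t) i + nth 0 (spine t) j + (j - i) \in path_lengths t.
Proof.
elim: t i j => [|a IHa b IHb] i j /=; first lia.
rewrite !mem_cat; case: (leqP (height b)) => h.
- case: i j => [|i] [|j] hij; try lia; last first.
    by rewrite /= subSS IHa ?orbT //; lia.
  apply/orP; left; apply/allpairsP.
  exists (j + nth 0 (spine a) j, min_depth b).
  by split; rewrite ?min_depth_in ?spine_depth //=; lia.
- case: i j => [|i] [|j] hij; try lia; last first.
    by rewrite /= subSS IHb ?orbT //; lia.
  apply/orP; left; apply/allpairsP.
  exists (min_depth a, j + nth 0 (spine b) j).
  by split; rewrite ?min_depth_in ?spine_depth //=; lia.
Qed.

(** * Counting lengths by separated translates *)

(** Up to the shift [w], the translate of [X] by [g r] lies in the [r]-th block of length [D].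
    Blocks are disjoint, so all sums [x + g r] differ. *)
Lemma separated_translates (L X : seq nat) (g : nat -> nat) (D R w : nat) :
  uniq X ->
  (forall x r, x \in X -> 0 < r <= R ->
     (x + g r \in L) /\ D * r <= x + g r + w < D * r.+1) ->
  R * size X <= size L.
Proof.
move=> uX H.
have eqr x r r' x' : x \in X -> x' \in X -> 0 < r <= R -> 0 < r' <= R ->
    x + g r = x' + g r' -> r <= r'.
  move=> xX x'X hr hr' E; have [_ h] := H _ _ xX hr.
  have [_ h'] := H _ _ x'X hr'.
  by rewrite E in h; nia.
rewrite -(size_iota 1 R) -(size_allpairs (fun r x => x + g r)).
apply: uniq_leq_size.
  apply: allpairs_uniq; rewrite ?iota_uniq //.
  move=> [r x] [r' x'] /allpairsP[[r1 x1] [/= ri xX [-> ->]]].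
  move=> /allpairsP[[r2 x2] [/= ri' xX' [-> ->]]] E.
  rewrite !mem_iota in ri ri'.
  have er : r1 = r2.
    by apply/eqP; rewrite eqn_leq (eqr x1 r1 r2 x2) ?(eqr x2 r2 r1 x1) //; lia.
  by rewrite er in E *; congr (_, _); lia.
move=> _ /allpairsP[[r x] [/= ri xX ->]].
by rewrite mem_iota in ri; apply: (H _ _ xX _).1; lia.
Qed.

(* Among the indices k of a window of length W in the middle of the sequence,
   h + k and h - k cannot both take few values, as they determine k; each value
   of the first (second) kind reappears, translated, with every one of R
   indices far to the left (right). *)
Lemma window_count (L : seq nat) (h : nat -> nat) (m M W : nat) :
  m <= M ->
  (forall i, i < m -> 0 < h i <= W) ->
  (forall i j, i < j < m -> h i + h j + (j - i) <= M ->
     h i + h j + (j - i) \in L) ->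
  0 < W <= size L -> m ^ 2 <= 196 * size L ^ 3.
Proof.
move=> mM hW hL /andP[W0 WK].
(* The [7] leaves room for the window and for [R] steps of [3 * W] on either side of it. *)
set R := m %/ (7 * W).
have Rm : 7 * W * R <= m by rewrite mulnC leq_trunc_div.
have mR : m < 7 * W * R.+1 by rewrite mulnC ltn_ceil //; lia.
case: (posnP R) => [R0|R0].
  have {}mR : m <= 7 * size L by rewrite R0 in mR; lia.
  have : m ^ 2 <= (7 * size L) ^ 2 by rewrite leq_exp2r.
  have : size L ^ 2 <= size L ^ 3 by rewrite leq_pexp2l //; lia.
  by rewrite expnMn; lia.
set c := 3 * W * R.
have Wc : 3 * W <= c by rewrite leq_pmulr.
have cm : 2 * c + W <= m.
  have : W <= W * R by rewrite leq_pmulr.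
  by rewrite /c; lia.
have cW k : k < W -> c + k < m by lia.
have rc r : r <= R -> 3 * W * r <= c by move=> rR; rewrite leq_mul2l rR orbT.
have rW r : 0 < r -> 3 * W <= 3 * W * r by move=> r0; rewrite leq_pmulr.
pose S := undup [seq k + h (c + k) | k <- iota 0 W].
(* [W - k] replaces [-k] to stay in the naturals; the translates subtract [W] again, and the shift
   [W.-1] realigns the blocks. *)
pose B := undup [seq (W - k) + h (c + k) | k <- iota 0 W].
have RS : R * size S <= size L.
  apply: (@separated_translates L S
    (fun r => h (c - 3 * W * r) + 3 * W * r) (3 * W) R 0).
    exact: undup_uniq.
  move=> x r; rewrite mem_undup => /mapP[k]; rewrite mem_iota => kW -> rR.
  have rcr : 3 * W * r <= c by apply: rc; lia.
  have r0 : 3 * W <= 3 * W * r by apply: rW; lia.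
  have ck : c + k < m by apply: cW; lia.
  have h1 := hW _ ck; have h2 : 0 < h (c - 3 * W * r) <= W by apply: hW; lia.
  split; last by rewrite mulnS; lia.
  have -> : k + h (c + k) + (h (c - 3 * W * r) + 3 * W * r) =
    h (c - 3 * W * r) + h (c + k) + (c + k - (c - 3 * W * r)) by lia.
  by apply: hL; lia.
have RB : R * size B <= size L.
  apply: (@separated_translates L B
    (fun r => h (c + 3 * W * r) + 3 * W * r - W) (3 * W) R W.-1).
    exact: undup_uniq.
  move=> x r; rewrite mem_undup => /mapP[k]; rewrite mem_iota => kW -> rR.
  have rcr : 3 * W * r <= c by apply: rc; lia.
  have r0 : 3 * W <= 3 * W * r by apply: rW; lia.
  have cr : c + 3 * W * r < m by lia.
  have ck : c + k < m by apply: cW; lia.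
  have h1 := hW _ ck; have h2 := hW _ cr.
  split; last by rewrite mulnS; lia.
  have -> : W - k + h (c + k) + (h (c + 3 * W * r) + 3 * W * r - W) =
    h (c + k) + h (c + 3 * W * r) + (c + 3 * W * r - (c + k)) by lia.
  by apply: hL; lia.
have WSB : W <= size S * size B.
  rewrite -(size_allpairs pair) -{1}(size_iota 0 W).
  rewrite -(size_map (fun k => (k + h (c + k), (W - k) + h (c + k)))).
  apply: uniq_leq_size.
    rewrite map_inj_in_uniq ?iota_uniq // => k k'.
    by rewrite !mem_iota => kW kW' [] ? ?; lia.
  move=> _ /mapP[k kW ->]; apply/allpairsP.
  exists (k + h (c + k), (W - k) + h (c + k)); split=> //=;
    by rewrite mem_undup; apply/mapP; exists k.
(* As [R] is positive, [R.+1 <= 2 * R]; this doubles the [7], and [196 = 14 ^ 2]. *)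
have m14 : m <= 14 * (W * R).
  have : 7 * W <= 7 * W * R by rewrite leq_pmulr.
  by rewrite mulnS in mR; lia.
have m2 : m ^ 2 <= 196 * (W * (W * R ^ 2)).
  have : m ^ 2 <= (14 * (W * R)) ^ 2 by rewrite leq_exp2r.
  by rewrite !expnMn; lia.
have RK : W * R ^ 2 <= size L ^ 2.
  apply: leq_trans (leq_mul RS RB).
  by rewrite mulnACA mulnn mulnC leq_mul2l WSB orbT.
apply: leq_trans m2 _; rewrite leq_mul2l /= (expnS (size L) 2).
exact: leq_mul.
Qed.

Lemma btree_count t (L : seq nat) (N : nat) :
  uniq L -> 0 \in L ->
  (forall l, l <= N -> l \in path_lengths t -> l \in L) ->
  N <= (height t).*2 + 2 -> N ^ 2 <= 1728 * size L ^ 3.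
Proof.
move=> uL L0 hL hN.
(* The inequality is strict because [0] counts as well. *)
have evens q : q <= max_min_depth t -> q.*2 <= N -> q < size L.
  move=> qt qN; rewrite -(size_iota 0 q.+1) -(size_map double).
  apply: uniq_leq_size; first by rewrite (map_inj_uniq double_inj) iota_uniq.
  move=> _ /mapP[k + ->]; rewrite mem_iota => kq.
  case: k kq => [|k] kq //; apply: hL; first lia.
  by apply: even_path_length; lia.
have K0 : 0 < size L by case: (L) L0.
have K23 : size L ^ 2 <= size L ^ 3 by rewrite leq_pexp2l.
have K13 : 1 <= size L ^ 3 by rewrite expn_gt0 K0.
(* If [big], the even lengths up to [N] already suffice. *)
have [small|big] := leqP (max_min_depth t).*2 N; last first.
  have hK : N <= 2 * size L by have := evens N./2; lia.
  have : N ^ 2 <= (2 * size L) ^ 2 by rewrite leq_exp2r.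
  by rewrite expnMn; lia.
(* Cutting the spine at [N] keeps the lengths used within [N]. *)
pose m := minn N (height t).
have mN : N <= 2 * m.+1 by rewrite /m; lia.
have : m ^ 2 <= 196 * size L ^ 3.
  apply: (@window_count L (nth 0 (spine t)) m N (max_min_depth t).+1).
  - exact: geq_minl.
  - by move=> i im; apply/spine_bound/mem_nth; rewrite size_spine /m in im *; lia.
  - by move=> i j ij lN; apply: hL => //; apply: spine_path_length; lia.
  - by rewrite /= evens.
have : N ^ 2 <= (2 * m.+1) ^ 2 by rewrite leq_exp2r.
(* From [(m + 1)^2 <= 2 * (m^2 + 1)] the constant is [8 * 196 + 8], rounded up to the cube
   [1728]. *)
have := (nat_Cauchy m 1).1; rewrite muln1 exp1n => AM.
by rewrite expnMn -addn1 sqrnD muln1 exp1n; lia.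
Qed.

(** * Unfolding a 1--3 tree into a binary tree *)

Section TreeUnfolding.
Variables (T : finType) (e : rel T).

(** A local condition, so walks are easy to glue; in an acyclic graph it forces distinct
    vertices. *)
Fixpoint nonbacktracking (s : seq T) : bool :=
  if s is x :: s1 then
    if s1 is y :: s2 then
      [&& e x y, ohead s2 != Some x & nonbacktracking s1]
    else true
  else true.

(* The component of y after deletion of the edge xy, rooted at y, is a copy of
   t. *)
Fixpoint unfolds (x y : T) (t : btree) : Prop :=
  match t with
  | Lf => leaf e y
  | Nd a b => exists u v, [/\ uniq [:: x; u; v],
      (forall z, e y z = (z \in [:: x; u; v])), unfolds y u a & unfolds y v b]
  end.

Lemma nonbacktracking_sorted s : nonbacktracking s -> sorted e s.
Proof.
elim: s => [//|x [|y s] IH] //= /and3P[exy _ nb].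
by rewrite exy; apply: IH.
Qed.

Lemma nonbacktracking_cat s1 a b s2 :
  nonbacktracking (s1 ++ [:: a, b & s2]) =
  nonbacktracking (s1 ++ [:: a; b]) && nonbacktracking [:: a, b & s2].
Proof.
elim: s1 => [|x [|y s1] IH] /=.
- by case: (e a b); rewrite //= andbT.
- by rewrite /= andbT -!andbA; case: (e a b); rewrite ?andbF //= andbT.
- rewrite /= in IH; rewrite IH -!andbA.
  by case: s1 {IH} => [|z s1].
Qed.

Hypothesis e_sym : symmetric e.

Lemma nonbacktracking_rev s : nonbacktracking (rev s) = nonbacktracking s.
Proof.
elim: s => [//|x [//|y s] IH].
rewrite !rev_cons -!cats1 -catA /= in IH *.
case: s IH => [|z s] IH /=; first by rewrite e_sym.
rewrite !rev_cons -!cats1 -!catA /= in IH *.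
rewrite (nonbacktracking_cat _ z y [:: x]) IH /= -(e_sym y z) -(e_sym x y).
rewrite !andbT /= -!andbA.
have -> : (Some x != Some z) = (Some z != Some x) by rewrite eq_sym.
by case: (e y z); case: (e x y); case: (Some z != _); case: (_ != Some y);
  rewrite ?andbT ?andbF.
Qed.

Hypothesis e_irr : irreflexive e.
Hypothesis e_acyclic : acyclic_graph e.

(** If the first vertex recurs, the segment before its recurrence is a cycle; sizes 1 and 2 would be
    a loop or a backtrack. *)
Lemma nonbacktracking_uniq s : nonbacktracking s -> uniq s.
Proof.
elim: s => [//|x s IH] nb.
have us : uniq s by apply: IH; case: s nb => //= y s /and3P[].
rewrite /= us andbT; apply/negP => xs.
case/splitPr: xs us nb => p1 p2 us nb.
apply: (e_acyclic (c := x :: p1)).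
  case: p1 nb {us} => [|y [|z p1]] //=; first by rewrite e_irr.
  by rewrite eqxx /= andbF.
have := nonbacktracking_sorted nb; rewrite /= -cat_rcons cat_path => /andP[pp _].
rewrite /ucycle /= pp /=.
by move: us; rewrite cat_uniq /= => /and3P[-> /norP[-> _] _].
Qed.

Lemma depths_walk x y t d : e x y -> unfolds x y t -> d \in depths t ->
  exists p, [/\ nonbacktracking [:: x, y & p], size p = d & leaf e (last y p)].
Proof.
elim: t x y d => [|a IHa b IHb] x y d exy /=.
  by move=> ly; rewrite inE => /eqP->; exists [::]; rewrite /= exy.
case=> u [v [uq nbr ua vb]] /mapP[d' + ->].
move: uq; rewrite /= !inE negb_or => /and3P[/andP[xu xv] uv _].
rewrite mem_cat => /orP[] /[dup] dd.
- move/(IHa y u d' _ ua) => []; first by rewrite nbr !inE eqxx orbT.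
  move=> p [nb sp lp]; exists (u :: p); split=> //; last by rewrite /= sp.
  by move: nb => /= ->; rewrite exy eqE /= eq_sym xu.
- move/(IHb y v d' _ vb) => []; first by rewrite nbr !inE eqxx !orbT.
  move=> p [nb sp lp]; exists (v :: p); split=> //; last by rewrite /= sp.
  by move: nb => /= ->; rewrite exy eqE /= eq_sym xv.
Qed.

Lemma path_lengths_sound x y t l :
  unfolds x y t -> l \in path_lengths t -> leaf_path_length e l.
Proof.
elim: t x y => [//|a IHa b IHb] x y /=.
case=> u [v [uq nbr ua vb]]; rewrite !mem_cat => /or3P[|la|lb]; last 2 first.
- exact: IHa ua la.
- exact: IHb vb lb.
case/allpairsP=> [[d1 d2]] [/= h1 h2 ->].
move: uq; rewrite /= !inE negb_or => /and3P[_ uv _].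
have yu : e y u by rewrite nbr !inE eqxx orbT.
have yv : e y v by rewrite nbr !inE eqxx !orbT.
have [p1 [nb1 s1 l1]] := depths_walk yu ua h1.
have [p2 [nb2 s2 l2]] := depths_walk yv vb h2.
(* A reversed walk into one branch is joined at [y] to a walk into the other; [u] and [v] differ, so
   there is no backtrack. *)
have nb : nonbacktracking (rev (u :: p1) ++ [:: y, v & p2]).
  rewrite rev_cons -cats1 -catA /= nonbacktracking_cat; apply/andP; split.
    have -> : rev p1 ++ [:: u; y] = rev [:: y, u & p1].
      by rewrite !rev_cons -!cats1 -catA.
    by rewrite nonbacktracking_rev.
  by move: nb2 => /= ->; rewrite e_sym yu eqE /= eq_sym uv.
rewrite lastI rev_rcons cat_cons in nb.
set p := rev (belast u p1) ++ [:: y, v & p2] in nb.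
have sp : size p == d1 + d2 + 2.
  by rewrite size_cat size_rev size_belast /= s1 s2; lia.
apply/existsP; exists (last u p1); apply/existsP; exists (Tuple sp).
rewrite /leaf_path /= l1 last_cat /= l2 !andbT.
have := nonbacktracking_uniq nb => /= ->.
by have := nonbacktracking_sorted nb => /= ->.
Qed.

Hypothesis e_deg : forall x, degree e x = 1 \/ degree e x = 3.

Lemma unfolds_exists x y : e x y -> exists t, unfolds x y t.
Proof.
move=> exy.
(* The walk [s] made so far has distinct vertices, so [k] bounds the steps still possible. *)
suff H k s x1 y1 : nonbacktracking (s ++ [:: x1; y1]) -> #|T| <= size s + k ->
    exists t, unfolds x1 y1 t.
  by apply: (H #|T| [::]); rewrite //= exy.
elim: k s x1 y1 => [|k IH] s {exy}x {}y nb sk.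
  have : size (s ++ [:: x; y]) <= #|T|.
    by rewrite -(card_uniqP (nonbacktracking_uniq nb)) max_card.
  by rewrite size_cat => /leq_trans/(_ sk) /=; lia.
have yx : e y x.
  by move: nb; rewrite nonbacktracking_cat e_sym /= andbT => /andP[_].
case: (e_deg y) => dy; first by exists Lf; apply/eqP.
have /cards2P[u [v [uv E]]] : #|[set z | e y z] :\ x| == 2.
  by move: dy; rewrite /degree (cardsD1 x) inE yx add1n => -[->].
have nbr z : e y z = (z \in [:: x; u; v]).
  have := in_setD1 z [set z | e y z] x; rewrite E !inE.
  by case: (eqVneq z x) => [->|_ /= <-] //; rewrite yx.
have xuv : x \notin [set u; v] by rewrite -E !inE eqxx.
rewrite !inE in xuv.
have ext z : z \in [set u; v] -> exists t, unfolds y z t.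
  move=> zuv; apply: (IH (rcons s x)); last by rewrite size_rcons; lia.
  rewrite cat_rcons nonbacktracking_cat nb /= e_sym yx andbT.
  rewrite nbr; move: zuv; rewrite eqE /= !inE => /[dup] zuv ->; rewrite orbT andbT.
  by apply: contra xuv => /eqP <-.
have [|a ua] := ext u; first by rewrite !inE eqxx.
have [|b vb] := ext v; first by rewrite !inE eqxx orbT.
by exists (Nd a b), u, v; split=> //=; rewrite !inE xuv uv.
Qed.

(** [V] is the vertex set of the copy of [t], which only the edge to [x] leaves. *)
Lemma unfolds_closed x y t : e x y -> unfolds x y t ->
  exists V : {set T}, [/\ #|V| < 2 ^ (height t).+1, y \in V &
    forall a b, a \in V -> e a b -> b = x \/ b \in V].
Proof.
elim: t x y => [|a IHa b IHb] x y exy /=.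
  move=> /eqP/eqP/cards1P[z Ez]; exists [set y]; rewrite cards1 set11; split=> //.
  move=> c d; rewrite inE => /eqP-> yd; left.
  have : d \in [set z] by rewrite -Ez inE.
  have : x \in [set z] by rewrite -Ez inE e_sym.
  by rewrite !inE => /eqP-> /eqP.
case=> u [v [uq nbr ua vb]].
have yu : e y u by rewrite nbr !inE eqxx orbT.
have yv : e y v by rewrite nbr !inE eqxx !orbT.
have [Va [ca ya cla]] := IHa _ _ yu ua.
have [Vb [cb yb clb]] := IHb _ _ yv vb.
exists (y |: (Va :|: Vb)); split; last 2 first.
- by rewrite !inE eqxx.
- move=> c d; rewrite !inE => /or3P[/eqP->|cV|cV].
  + by rewrite nbr !inE => /or3P[] /eqP->; rewrite ?ya ?yb ?orbT; [left|right|right].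
  + by move/(cla _ _ cV) => [->|->]; right; rewrite ?eqxx ?orbT.
  + by move/(clb _ _ cV) => [->|->]; right; rewrite ?eqxx ?orbT.
have pa : 2 ^ (height a).+1 <= 2 ^ (maxn (height a) (height b)).+1.
  by rewrite leq_exp2l // ltnS leq_maxl.
have pb : 2 ^ (height b).+1 <= 2 ^ (maxn (height a) (height b)).+1.
  by rewrite leq_exp2l // ltnS leq_maxr.
rewrite [2 ^ _.+2]expnS.
have := cardsUI Va Vb; have := cardsU1 y (Va :|: Vb); move=> -> hU.
by move: (y \notin _) => c; have := leq_b1 c; lia.
Qed.

Lemma exists_leaf (x : T) : exists r, leaf e r.
Proof.
have /set0Pn[y] : [set y | e x y] != set0.
  by rewrite -card_gt0 -/(degree e x); case: (e_deg x) => ->.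
rewrite inE => xy; have [t xyt] := unfolds_exists xy.
by have [p [_ _ lp]] := depths_walk xy xyt (min_depth_in t); exists (last y p).
Qed.

(** Adding the root [r] to that set makes it closed under adjacency, hence everything by
    connectedness. *)
Lemma card_unfolding r y t : (forall a b, connect e a b) -> leaf e r -> e r y ->
  unfolds r y t -> #|T| <= 2 ^ (height t).+1.
Proof.
move=> conn /eqP/eqP/cards1P[z Ez] ry uf.
have rn b : e r b -> b = y.
  have : y \in [set b | e r b] by rewrite inE.
  rewrite Ez inE => /eqP->.
  by move=> rb; apply/set1P; rewrite -Ez inE.
have [V [cV yV clV]] := unfolds_closed ry uf.
have cl : closed e (mem (r |: V)).
  apply: intro_closed; first exact: sym_connect_sym.
  move=> a b ab; rewrite !inE => /orP[/eqP ra|aV].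
    by rewrite (rn b) ?yV ?orbT // -ra.
  by have [->|->] := clV _ _ aV ab; rewrite ?eqxx ?orbT.
have sub : setT \subset r |: V.
  apply/subsetP => b _; have := closed_connect cl (conn r b).
  by rewrite /= !inE eqxx => <-.
have := subset_leq_card sub; rewrite cardsT cardsU1.
by move: (r \notin _) => c; have := leq_b1 c; lia.
Qed.

End TreeUnfolding.

(** * The bound for 1--3 trees *)

Lemma tree13_count (T : finType) (e : rel T) (N : nat) : tree13 e ->
  2 ^ N <= #|T| ^ 2 -> N ^ 2 <= 1728 * #|leaf_path_lengths e N| ^ 3.
Proof.
move=> [[[e_sym e_irr] [T0 conn] acy] deg] hN.
have /card_gt0P[x _] := T0.
have [r lr] := exists_leaf e_sym e_irr acy deg x.
have /set0Pn[y] : [set y | e r y] != set0.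
  by rewrite -card_gt0 -/(degree e r) (eqP lr).
rewrite inE => ry; have [t uf] := unfolds_exists e_sym e_irr acy deg ry.
have cT := card_unfolding e_sym conn lr ry uf.
have sz : size [seq val l | l in leaf_path_lengths e N] = #|leaf_path_lengths e N|.
  exact: size_image.
rewrite -sz; apply: (@btree_count t).
- by rewrite map_inj_uniq ?enum_uniq //; apply: val_inj.
- apply/imageP; exists ord0 => //; rewrite inE.
  apply/existsP; exists r; apply/existsP; exists [tuple].
  by rewrite /leaf_path /= lr.
- move=> l lN ll; apply/imageP; exists (inord l); last by rewrite /= inordK.
  by rewrite inE inordK //; apply: path_lengths_sound uf ll.
- have : 2 ^ N <= 2 ^ ((height t).+1 * 2).
    by apply: leq_trans hN _; rewrite expnM leq_exp2r.
  by rewrite leq_exp2l //; lia.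
Qed.

Local Open Scope ring_scope.

Theorem theorem1p7 (R : realType) :
  exists2 alpha : R, 0 < alpha &
    forall N n : nat, (1 <= N)%N -> ~~ odd n ->
      (2 : R) `^ (N%:R / 2) <= n%:R ->
      forall (T : finType) (e : rel T),
        #|T| = n -> tree13 e ->
        alpha * N%:R `^ (2 / 3) <= #|leaf_path_lengths e N|%:R.
Proof.
(* [12 ^ 3 = 1728]; both sides are cubed at the end. *)
exists 12%:R^-1; first by rewrite invr_gt0 ltr0n.
move=> N n N1 _ hn T e cT tree.
have {}hn : (2 ^ N <= #|T| ^ 2)%N.
  rewrite cT -(ler_nat R) !natrX.
  have -> : 2 ^+ N = ((2 : R) `^ (N%:R / 2)) ^+ 2.
    by rewrite -[RHS]powR_mulrn ?powR_ge0 // -powRrM divfK ?pnatr_eq0 // powR_mulrn.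
  by rewrite lerXn2r // nnegrE ?powR_ge0.
have := tree13_count tree hn; set K := #|_| => hK.
rewrite mulrC ler_pdivrMr ?ltr0n // -(@ler_pXn2r _ 3) ?nnegrE ?powR_ge0 ?mulr_ge0 //.
rewrite -powR_mulrn ?powR_ge0 // -powRrM divfK ?pnatr_eq0 // powR_mulrn //.
by rewrite -natrM -!natrX ler_nat expnMn mulnC.
Qed.
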